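(* (a) Every integer $m\ge 122$ can be written as $m=p_1+\dots+p_k$ for some $k\ge 1$ and pairwise distinct primes $p_1,\dots,p_k$, each congruent to $1$ modulo $4$. (b) Every integer $m\ge 56$ can be written as $m=q_1+\dots+q_\ell$ for some $\ell\ge 1$ and pairwise distinct primes $q_1,\dots,q_\ell$, each congruent to $3$ modulo $4$. *)

(* Defs.v *)
From mathcomp Require Import all_boot.

(* Main.v *)
(* Fix a class a = 1, 3 mod 4. Following Erdős, let N = 3K and compare the
   product A of the N numbers 4i + a (i < N) with N!. For an odd prime p the
   p-adic valuation of A exceeds that of N! by at most log_p(4N), and a prime
   p > 4N/3 = 4K dividing A lies in the class a. Hence A 2^(v_2(N!)) / N!, which
   is at least 8^N / (8 N^2), is at most (4N)^sqrt(4N) times the primorial of 4K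
   (at most 4^(4K)) times (4N)^k, where k counts the primes of the class in
   (4K, 12K). As 8^N / 4^(4K) = 2^K, this forces k >= 6 for K >= 2^13.

   Following Richert, if the subset sums of a set of primes of the class, all at
   most 4K, contain the interval [M, M + 12K], then adding the primes of the
   class in (4K, 12K) one at a time lengthens the interval by at least
   6 * 4K = 24K, which reproduces the hypothesis with 3K in place of K. The
   case K = 2^13 is an explicit computation. *)
Require Import Defs.
From mathcomp Require Import all_boot zify.

(** * Chebyshev-type bound on the primorial *)

Definition primorial n := \prod_(p < n.+1 | prime p) p.

Lemma dvdn_prod_primes X (P : pred nat) m :
  (forall p, P p -> prime p) -> (forall p, p < X -> P p -> p %| m) ->
  \prod_(p < X | P p) p %| m.
Proof.
move=> primeP; elim: X => [|X IH] Hm; first by rewrite big_ord0 dvd1n.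
rewrite big_mkcond big_ord_recr -big_mkcond /=.
have {}IH : \prod_(p < X | P p) p %| m by apply: IH => p pX; apply: Hm; lia.
case: ifP => [PX|_]; last by rewrite muln1.
rewrite Gauss_dvd ?IH ?Hm //.
apply: (big_ind (fun m => coprime m X)) => [|x y cx cy|i Pi].
- exact: coprime1n.
- by rewrite coprimeMl cx cy.
rewrite prime_coprime ?primeP // dvdn_prime2 ?primeP //.
by rewrite neq_ltn ltn_ord.
Qed.

(** The two equal middle coefficients both occur in the expansion of [2 ^ m.*2.+1]. *)
Lemma leq_bin_odd m : 'C(m.*2.+1, m) <= 4 ^ m.
Proof.
have E := expnDn 1 1 m.*2.+1.
have H : 'C(m.*2.+1, m) * 2 <= 2 ^ m.*2.+1.
  rewrite -[2]/(1 + 1) E.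
  under eq_bigr do rewrite !exp1n !muln1.
  have m1 : m < m.*2.+2 by lia.
  have m2 : m.+1 < m.*2.+2 by lia.
  rewrite (bigD1 (Ordinal m1)) //= (bigD1 (Ordinal m2)) /=; last first.
    by rewrite -val_eqE /=; lia.
  have -> : 'C(m.*2.+1, m.+1) = 'C(m.*2.+1, m).
    rewrite -bin_sub; last by lia.
    by congr 'C(_, _); lia.
  lia.
move: H; rewrite expnS -mul2n expnM -[2 ^ 2]/4; lia.
Qed.

Lemma prime_dvd_fact p n : prime p -> (p %| n`!) = (p <= n).
Proof.
move=> pp; elim: n => [|n IH].
  by rewrite Euclid_dvd1 // leqn0; have := prime_gt0 pp; case: p {pp}.
rewrite factS Euclid_dvdM // IH; apply/orP/idP => [[/dvdn_leq->|]//|]; first by lia.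
by rewrite leq_eqVlt ltnS => /orP[/eqP->|->]; [left|right].
Qed.

(** Induction: an even number above 2 adds no prime, and for [n = 2m + 1] the primes in
    [(m + 1, 2m + 1]] all divide ['C(2m + 1, m)]. *)
Lemma leq_primorial n : primorial n <= 4 ^ n.
Proof.
have [k] := ubnP n; elim: k n => // k IH n /ltnSE nk.
have rec m : primorial m.+1 = primorial m * (if prime m.+1 then m.+1 else 1).
  by rewrite /primorial big_mkcond big_ord_recr -big_mkcond.
case: n nk => [|[|[|n]]] nk.
- by rewrite /primorial big1 // => -[[|i] ?].
- by rewrite /primorial big1 // => -[[|[|i]] ?].
- by rewrite !rec /primorial big1 // => -[[|i] ?].
have [en|on] := boolP (odd n).
  rewrite rec ifF ?muln1.
    by apply: leq_trans (IH _ _) _; [lia | rewrite leq_exp2l].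
  apply/negbTE/negP => pn; have [|] := even_prime pn; first by lia.
  by rewrite /= en.
have [m m0 E] : exists2 m, 0 < m & n.+3 = m.*2.+1 by exists (n.+2)./2; lia.
rewrite E in nk *.
set P := [pred p | prime p && (m.+1 < p)].
have -> : primorial m.*2.+1 = primorial m.+1 * \prod_(p < m.*2.+2 | P p) p.
  rewrite /primorial (bigID [pred p : 'I__ | p < m.+2]) /=.
  congr (_ * _); last by apply: eq_bigl => p /=; rewrite -leqNgt.
  rewrite -(big_ord_widen_cond m.*2.+2 prime id); last by lia.
  by [].
have -> : 4 ^ m.*2.+1 = 4 ^ m.+1 * 4 ^ m by rewrite -expnD; congr (4 ^ _); lia.
apply: leq_mul; first by apply: IH; lia.
apply: leq_trans (leq_bin_odd m); apply: dvdn_leq; first by rewrite bin_gt0; lia.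
apply: dvdn_prod_primes => [p /andP[]//|p pm /andP[pp mp]].
have : m <= m.*2.+1 by lia.
move=> /bin_fact; rewrite (_ : _ - m = m.+1) => [facE|]; last by lia.
have : p %| (m.*2.+1)`! by rewrite prime_dvd_fact.
by rewrite -facE 2?Euclid_dvdM // !prime_dvd_fact // => /or3P[//||]; lia.
Qed.

(** * Valuations of factorials and of products over a progression *)

Lemma two_exp_leq_logn_fact n : 2 ^ n.+1 <= 2 * n.+1 * 2 ^ logn 2 n.+1`!.
Proof.
have dbl m : m + logn 2 m`! <= logn 2 (m.*2)`!.
  elim: m => // m IH; rewrite doubleS !factS -doubleS.
  rewrite !lognM ?muln_gt0 ?fact_gt0 //.
  have -> : logn 2 m.+1.*2 = (logn 2 m.+1).+1 by rewrite -muln2 lognM // addn1.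
  lia.
have [k] := ubnP n; elim: k n => // k IH n /ltnSE nk.
case: n nk => [|n] nk //.
have [m mn [b E]] : exists2 m, m < k & exists b : bool, n.+2 = m.+1.*2 + b.
  by exists n./2; [lia | exists (odd n); lia].
have := IH m mn; have := dbl m.+1.
have : logn 2 (m.+1.*2)`! <= logn 2 (n.+2)`!.
  apply: dvdn_leq_log; rewrite ?fact_gt0 // E.
  by case: (b); rewrite ?addn0 // addn1 factS dvdn_mull.
move=> H1 H2 H3.
have : 2 ^ (m.+1 + logn 2 m.+1`!) <= 2 ^ logn 2 n.+2`! by rewrite leq_exp2l //; lia.
rewrite expnD; move: H3; move: (2 ^ logn 2 n.+2`!) => z.
have -> : 2 ^ n.+2 = 2 ^ m.+1 * 2 ^ m.+1 * 2 ^ b by rewrite -!expnD; congr (2 ^ _); lia.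
move: (2 ^ m.+1) (2 ^ logn 2 _) => x y xy xyz.
have xxz : x * x <= 2 * m.+1 * z by apply: (leq_trans (n := x * (2 * m.+1 * y))); nia.
by rewrite E; case: (b); rewrite ?expn1 ?expn0; nia.
Qed.

(** As 4 is invertible modulo [q], the indices counted share one residue, so [i %/ q] separates
    them. *)
Lemma count_dvd_progression q a N : coprime q 4 -> 0 < q ->
  \sum_(i < N) (q %| 4 * i + a) <= (N %/ q).+1.
Proof.
move=> cq q0; rewrite -big_mkcond /= sum1_card -[X in _ <= X]card_ord.
pose f (i : 'I_N) : 'I_(N %/ q).+1 := inord (i %/ q).
apply: (@leq_card_in _ _ f) => i j; rewrite !unfold_in => qi qj /(congr1 val).
have lt_f (k : 'I_N) : k %/ q < (N %/ q).+1 by rewrite ltnS leq_div2r // ltnW.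
rewrite /= !inordK // => eq_div; apply/val_inj => /=.
rewrite (divn_eq i q) (divn_eq j q) eq_div; congr (_ + _).
apply/eqP; wlog le_ij : i j qi qj {eq_div} / i <= j.
  by move=> W; have [/W->//|/ltnW /W] := leqP i j; rewrite eq_sym => ->.
rewrite eq_sym eqn_mod_dvd // -(Gauss_dvdr _ cq).
have -> : 4 * (j - i) = 4 * j + a - (4 * i + a) by lia.
by rewrite dvdn_subr //; lia.
Qed.

Definition progression_prod a N := \prod_(i < N) (4 * i + a).

Lemma progression_prod_gt0 a N : 0 < a -> 0 < progression_prod a N.
Proof. by move=> a0; apply: prodn_gt0 => i; rewrite addn_gt0 a0 orbT. Qed.

Lemma logn_sum_dvd p m T : prime p -> 0 < m -> m < p ^ T.+1 ->
  logn p m = \sum_(i < T) (p ^ i.+1 %| m).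
Proof.
move=> pp m0 mT.
have lT : logn p m <= T.
  rewrite -ltnS -(ltn_exp2l _ _ (prime_gt1 pp)); apply: leq_ltn_trans mT.
  by rewrite dvdn_leq // pfactor_dvdnn.
under eq_bigr do rewrite pfactor_dvdn //.
rewrite -(subnKC lT) big_split_ord /= [X in _ + X]big1 => [|i _]; last first.
  by case: leqP => //; lia.
rewrite addn0 (eq_bigr (fun=> 1)) ?sum1_card ?card_ord // => i _.
by rewrite ltn_ord.
Qed.

Lemma sum_divn_leq_logn_fact p N T : prime p ->
  \sum_(i < T) N %/ p ^ i.+1 <= logn p N`!.
Proof.
move=> pp; rewrite logn_fact // big_add1 /= big_mkord.
have [TN|/ltnW NT] := leqP T N.
  by rewrite -(subnKC TN) big_split_ord leq_addr.
rewrite -(subnKC NT) big_split_ord /= [X in _ + X]big1 ?addn0 // => i _.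
apply: divn_small; apply: leq_trans (ltn_expl _ (prime_gt1 pp)) _.
by rewrite leq_exp2l ?prime_gt1 //; lia.
Qed.

(** Each [p ^ k] divides at most [N %/ p ^ k + 1] terms, and all terms are below [4 * N], which
    bounds [k]. *)
Lemma logn_progression_prod p a N : prime p -> odd p -> 0 < a < 4 ->
  logn p (progression_prod a N) <= logn p N`! + trunc_log p (4 * N).
Proof.
move=> pp op /andP[a0 a4]; set T := trunc_log p _.
have -> : logn p (progression_prod a N) = \sum_(i < N) logn p (4 * i + a).
  rewrite /progression_prod; elim: N {T} => [|n IH]; first by rewrite !big_ord0 logn1.
  by rewrite !big_ord_recr /= lognM ?IH //; [apply: progression_prod_gt0 | lia].
have -> : \sum_(i < N) logn p (4 * i + a) =
    \sum_(i < N) \sum_(k < T) (p ^ k.+1 %| 4 * i + a).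
  apply: eq_bigr => i _; apply: logn_sum_dvd => //; first by lia.
  apply: leq_trans (trunc_log_ltn _ (prime_gt1 pp)).
  by have := ltn_ord i; lia.
rewrite exchange_big /=.
apply: (@leq_trans (\sum_(k < T) (N %/ p ^ k.+1).+1)).
  apply: leq_sum => k _; apply: count_dvd_progression.
    by rewrite coprimeXl // -[4]/(2 ^ 2) coprimeXr // coprimen2.
  by rewrite expn_gt0 prime_gt0.
under eq_bigr do rewrite -addn1.
by rewrite big_split /= sum1_card card_ord leq_add2r sum_divn_leq_logn_fact.
Qed.

(* A prime [p] outside the class of [a] divides a term only with cofactor at
   least 3, the cofactor being odd and different from 1. *)
Lemma logn_progression_prod_eq0 p a N : prime p -> odd a -> a < 4 ->
  4 * N <= 3 * p -> p %% 4 != a -> logn p (progression_prod a N) = 0.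
Proof.
move=> pp oa a4 Np pa; apply/eqP; rewrite lognE pp progression_prod_gt0 /=; last by lia.
rewrite ifF // Euclid_dvd_prod //; apply/negbTE/negP.
elim/big_ind: _ => // [x y hx hy /orP[]//|i _ /dvdnP[m E]].
have im := ltn_ord i.
case: m E => [|[|[|m]]] E; nia.
Qed.

(** Compare [4 * i + a] with [4 * i] for [i > 0]; the term at [i = 0] costs the factor [4 * N]. *)
Lemma progression_prod_lower a N : 0 < a -> 0 < N ->
  4 ^ N * N`! <= 4 * N * progression_prod a N.
Proof.
case: N => // N a0 _.
suff H : 4 ^ N * N`! <= progression_prod a N.+1 by rewrite factS expnS; nia.
elim: N => [|N IH]; first by rewrite /progression_prod big_ord_recr big_ord0 /= muln0 !mul1n.
rewrite /progression_prod big_ord_recr -/(progression_prod a N.+1) factS expnS /=.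
by apply: (@leq_trans (4 ^ N * N`! * (4 * N.+1 + a))); nia.
Qed.

(** * Counting primes of the class in (4K, 12K) *)

Definition class_primes a lo hi :=
  [seq p <- iota 0 hi | [&& lo < p, prime p & p %% 4 == a]].

(* Exponents dominating those of the quotient of [progression_prod a (3 * K)]
   by the odd part of [(3 * K)`!]. *)
Definition quotient_bound a K :=
  \prod_(p < 12 * K | prime p && ((p <= 4 * K) || (p %% 4 == a)))
    p ^ trunc_log p (12 * K).

Lemma progression_prod_dvdn a K : odd a -> a < 4 ->
  progression_prod a (3 * K) * 2 ^ logn 2 (3 * K)`! %| (3 * K)`! * quotient_bound a K.
Proof.
move=> oa a4; have a0 : 0 < a by case: a oa {a4}.
have A0 := progression_prod_gt0 a (3 * K) a0.
have R0 : 0 < quotient_bound a K.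
  by apply: prodn_cond_gt0 => p /andP[pp _]; rewrite expn_gt0 prime_gt0.
apply/dvdn_partP => [|p]; first by rewrite muln_gt0 A0 expn_gt0.
rewrite mem_primes => /and3P[pp _ _].
rewrite p_part pfactor_dvdn ?muln_gt0 ?fact_gt0 //.
rewrite !lognM ?fact_gt0 ?expn_gt0 // lognX.
have [op|p2] := boolP (odd p); last first.
  have {pp p2}-> : p = 2 by case: (even_prime pp) => // op; rewrite op in p2.
  suff -> : logn 2 (progression_prod a (3 * K)) = 0 by rewrite muln1 leq_addr.
  apply: logn_coprime; rewrite coprime2n /progression_prod.
  apply: (big_ind odd) => // [x y ox oy|i _]; first by rewrite oddM ox.
  by rewrite oddD oddM oa.
have -> : logn p 2 = 0 by rewrite lognE pp dvdn_prime2 //; case: eqP op => // ->.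
rewrite muln0 addn0.
have [/andP[pK pa]|] := boolP ((4 * K < p) && (p %% 4 != a)).
  by rewrite logn_progression_prod_eq0 //; lia.
rewrite negb_and -leqNgt negbK => pP.
have := logn_progression_prod p a (3 * K) pp op; rewrite a0 a4 => /(_ isT) HA.
apply: (leq_trans HA); rewrite leq_add2l mulnA.
have [->//|T0] := posnP (trunc_log p (12 * K)).
(* A positive exponent gives [p <= 12 * K], and oddness excludes equality, so [p] indexes a factor
   of [quotient_bound]. *)
have pX : p < 12 * K.
  move: T0; rewrite trunc_log_gt0 prime_gt1 //= => pK.
  by case: (p =P 12 * K) pp op => [->|]; first rewrite oddM; lia.
rewrite -pfactor_dvdn // /quotient_bound (bigD1 (Ordinal pX)) /= ?pp ?pP //.
exact: dvdn_mulr.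
Qed.

Lemma prod_if_const X (P : pred nat) c :
  \prod_(p < X) (if P p then c else 1) = c ^ count P (iota 0 X).
Proof.
elim: X => [|X IH]; first by rewrite big_ord0.
rewrite big_ord_recr IH -[in RHS]addn1 iotaD count_cat expnD /= addn0.
by case: (P X); rewrite ?expn1 ?expn0.
Qed.

(** Each prime power is at most [12 * K]. Primes above [r] have exponent at most 1, so those up to
    [4 * K] are absorbed by the primorial; the rest are class primes. *)
Lemma leq_quotient_bound a K r : 0 < K -> 12 * K < r.+1 ^ 2 ->
  quotient_bound a K <=
    (12 * K) ^ r * primorial (4 * K) * (12 * K) ^ size (class_primes a (4 * K) (12 * K)).
Proof.
move=> K0; set X := 12 * K => Xr; have X0 : 0 < X by rewrite muln_gt0.
pose P1 p := 0 < p <= r; pose P2 p := (p <= 4 * K) && prime p.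
pose P3 p := [&& 4 * K < p, prime p & p %% 4 == a].
apply: (@leq_trans (\prod_(p < X) ((if P1 p then X else 1) * (if P2 p then p : nat else 1)
          * (if P3 p then X else 1)))).
  rewrite /quotient_bound big_mkcond; apply: leq_prod => p _.
  case: ifP => [/andP[pp pa]|_]; last first.
    have ifX0 (b : bool) : 0 < (if b then X else 1) by case: b.
    by rewrite !muln_gt0 !ifX0 andbT; case: ifP => // /andP[_ /prime_gt0].
  have leT : p ^ trunc_log p X <= X by rewrite trunc_logP ?prime_gt1.
  have p0 := prime_gt0 pp.
  rewrite /P1 /P2 /P3 pp p0 /=; have [pr|rp] := leqP p r.
    apply: leq_trans leT _; rewrite -mulnA leq_pmulr //.
    by rewrite muln_gt0; apply/andP; split; case: ifP.
  have [pK|Kp] := leqP p (4 * K); last by move: pa; rewrite leqNgt Kp /= => ->; rewrite !mul1n.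
  rewrite mul1n muln1 -[leqRHS]expn1 leq_exp2l ?prime_gt1 // -ltnS.
  rewrite -(ltn_exp2l _ _ (prime_gt1 pp)); apply: leq_ltn_trans leT _.
  by apply: leq_trans Xr _; rewrite leq_exp2r.
rewrite !big_split /= !prod_if_const; apply: leq_mul; first apply: leq_mul.
- rewrite leq_pexp2l //.
  rewrite -size_filter -[leqRHS](size_iota 1); apply: uniq_leq_size.
    by rewrite filter_uniq ?iota_uniq.
  by move=> p; rewrite mem_filter !mem_iota /P1; lia.
- rewrite -big_mkcond /primorial (big_ord_widen_cond X prime id); last by lia.
  by apply/eq_leq/eq_bigl => p; rewrite /P2 ltnS andbC.
- by rewrite size_filter.
Qed.

Lemma sqrt_bounds n : exists2 r, r ^ 2 <= n & n < r.+1 ^ 2.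
Proof.
elim: n => [|n [r r1 r2]]; first by exists 0.
have [|] := leqP (r.+1 ^ 2) n.+1; last by exists r => //; lia.
by exists r.+1 => //; nia.
Qed.

(** With [2 ^ t <= 12 * K], the constant [192 = 12 * 16] yields [16 * t.+1 ^ 2 <= K]. *)
Lemma square_leq_exp t : 16 <= t -> 192 * t.+1 ^ 2 <= 2 ^ t.
Proof.
move=> /subnK <-; elim: (t - 16) => [|s IH].
  by rewrite add0n (expnM 2 8 2) -[2 ^ 8]/(16 * 16) -[17]/(16 + 1); lia.
rewrite addSn -!mulnn [2 ^ _.+1]expnS in IH *; move: (2 ^ _) IH => y.
have : 17 <= (s + 16).+1 by lia.
by move: (s + 16).+1 => u; nia.
Qed.

(** The exponent is [r] for the small primes, 5 for the class primes if there are fewer than six,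
    and 2 for [72 * K ^ 2 <= (12 * K) ^ 2]. *)
Lemma pow_sqrt_lt_two_exp K r : 2 ^ 13 <= K -> r ^ 2 <= 12 * K -> 12 * K < r.+1 ^ 2 ->
  (12 * K) ^ (r + 7) < 2 ^ K.
Proof.
move=> K13 rK Kr; set t := trunc_log 2 (12 * K).
have K0 : 0 < 12 * K by rewrite muln_gt0 /=; apply: leq_trans K13; rewrite expn_gt0.
have /andP[tX Xt] := trunc_log_bounds (isT : 1 < 2) K0; rewrite -/t in tX Xt.
have t16 : 16 <= t.
  apply: trunc_log_max => //; apply: leq_trans (_ : 12 * 2 ^ 13 <= _).
    by rewrite (expnD 2 3 13) leq_mul.
  by rewrite leq_mul.
have tK : 16 * t.+1 ^ 2 <= K by have := square_leq_exp _ t16; lia.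
have r49 : 49 <= r.
  have : 4 ^ 6 <= K by apply: leq_trans K13; rewrite -[4]/(2 ^ 2) -expnM leq_exp2l.
  rewrite -[4 ^ 6]/(64 * 64); nia.
(* From [r >= 49], [7 * (r + 7) <= 8 * r]; after squaring, [64 * 12 / 16 = 48] is below [7 ^ 2]. *)
have trK : t.+1 * (r + 7) <= K.
  rewrite -(@leq_pmul2l 7) // -leq_sqr.
  apply: (@leq_trans ((8 * t.+1 * r) ^ 2)); first by rewrite leq_sqr; nia.
  have -> : (8 * t.+1 * r) ^ 2 = 64 * t.+1 ^ 2 * r ^ 2 by lia.
  nia.
apply: leq_trans (_ : (2 ^ t.+1) ^ (r + 7) <= _); first by rewrite ltn_exp2r // addnC.
by rewrite -expnM leq_exp2l.
Qed.

Lemma class_primes_size a K : odd a -> a < 4 -> 2 ^ 13 <= K ->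
  6 <= size (class_primes a (4 * K) (12 * K)).
Proof.
move=> oa a4 K13; have K0 : 0 < K by apply: leq_trans K13; rewrite expn_gt0.
have a0 : 0 < a by case: a oa {a4}.
rewrite leqNgt; apply/negP; rewrite ltnS => few.
have [r r1 r2] := sqrt_bounds (12 * K).
have := pow_sqrt_lt_two_exp _ _ K13 r1 r2; apply/negP; rewrite -leqNgt.
have N0 : 0 < 3 * K by rewrite muln_gt0.
have F0 := fact_gt0 (3 * K).
have R0 : 0 < quotient_bound a K.
  by apply: prodn_cond_gt0 => p /andP[pp _]; rewrite expn_gt0 prime_gt0.
have := dvdn_leq _ (progression_prod_dvdn a K oa a4); rewrite muln_gt0 F0 R0 => /(_ isT) AF.
have Alow := progression_prod_lower _ _ a0 N0.
have Vlow := two_exp_leq_logn_fact (3 * K).-1; rewrite (prednK N0) in Vlow.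
have Rup : quotient_bound a K <= (12 * K) ^ (r + 5) * 4 ^ (4 * K).
  apply: leq_trans (leq_quotient_bound a _ _ K0 r2) _.
  rewrite [_ ^ (r + 5)]expnD mulnAC leq_mul ?leq_primorial // leq_mul // leq_pexp2l //; lia.
have E8 : 4 ^ (3 * K) * 2 ^ (3 * K) = 2 ^ K * 4 ^ (4 * K).
  by rewrite -[4]/(2 ^ 2) -!expnM -!expnD; congr (2 ^ _); lia.
(* The losses [4 * N] and [2 * N] multiply to [72 * K ^ 2] for [N = 3 * K]. *)
have H : 2 ^ K * 4 ^ (4 * K) <= 72 * K ^ 2 * quotient_bound a K.
  rewrite -E8 -(leq_pmul2r F0).
  have M := leq_mul Alow Vlow.
  have M2 := leq_mul (leqnn (72 * K ^ 2)) AF.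
  move: M M2; move: (progression_prod _ _) (_ `!) (quotient_bound _ _) => A F R.
  move: (2 ^ logn _ _) (4 ^ _) (2 ^ _) => v x y M M2.
  apply: (@leq_trans (72 * K ^ 2 * (A * v))); last by lia.
  by apply: leq_trans (leq_trans M _); lia.
rewrite -(@leq_pmul2r (4 ^ (4 * K))) ?expn_gt0 //; apply: leq_trans H _.
apply: leq_trans (leq_mul (leqnn _) Rup) _; rewrite mulnA leq_mul2r; apply/orP; right.
have -> : r + 7 = 2 + (r + 5) by lia.
rewrite [leqRHS]expnD leq_mul2r; apply/orP; right.
by rewrite [leqRHS]expnMn leq_mul2r orbT.
Qed.

(** * Intervals filled by subset sums *)

Definition covers M L (ps : seq nat) :=
  forall m, M <= m <= M + L -> exists2 s, subseq s ps & sumn s = m.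

(** Sums using [p] fill the interval shifted by [p], which leaves no gap since [p <= L]. *)
Lemma covers_cons M L ps p : covers M L ps -> p <= L -> covers M (L + p) (p :: ps).
Proof.
move=> cov pL m /andP[Mm mL].
have [mM|Mm'] := leqP m (M + L).
  have [|s sps <-] := cov m; first by rewrite Mm.
  by exists s => //; apply: subseq_trans sps (subseq_cons _ _).
have [|s sps E] := cov (m - p); first by lia.
by exists (p :: s); rewrite /= ?eqxx // E; lia.
Qed.

Fixpoint grows L (qs : seq nat) :=
  if qs is q :: qs' then (q <= L) && grows (L + q) qs' else true.

Lemma covers_catrev M L ps qs :
  covers M L ps -> grows L qs -> covers M (L + sumn qs) (catrev qs ps).
Proof.
elim: qs L ps => [|q qs IH] L ps cov /=; first by rewrite addn0.
by move=> /andP[qL g]; rewrite addnA; apply: IH g; apply: covers_cons.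
Qed.

Lemma all_leq_grows L qs : all (fun q => q <= L) qs -> grows L qs.
Proof.
elim: qs L => //= q qs IH L /andP[-> qsL]; apply: IH.
by apply: sub_all qsL => p /leq_trans->//; apply: leq_addr.
Qed.

Definition class_prime a p := prime p && (p %% 4 == a).

(** The bound [B] keeps the primes in use distinct from those adjoined later. *)
Definition covering a M B L :=
  exists ps, [/\ uniq ps, all (class_prime a) ps, all (fun p => p <= B) ps & covers M L ps].

Lemma covering_step a M K : odd a -> a < 4 -> 2 ^ 13 <= K ->
  covering a M (4 * K) (12 * K) -> covering a M (12 * K) (36 * K).
Proof.
move=> oa a4 K13 [ps [ups aps bps cov]].
set qs := class_primes a (4 * K) (12 * K).
have qsP q : q \in qs -> [/\ 4 * K < q, q <= 12 * K & class_prime a q].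
  rewrite mem_filter mem_iota => /andP[/and3P[? pq qa] /andP[_ ?]].
  by rewrite /class_prime pq qa; split; lia.
exists (catrev qs ps); rewrite catrevE; split.
- rewrite cat_uniq rev_uniq ups andbT filter_uniq ?iota_uniq //=.
  apply/hasPn => p /(allP bps) pK; rewrite mem_rev; apply/negP => /qsP[Kp _ _]; lia.
- by rewrite all_cat aps andbT all_rev; apply/allP => q /qsP[].
- rewrite all_cat all_rev; apply/andP; split; first by apply/allP => q /qsP[].
  by apply: sub_all bps => p; lia.
have := covers_catrev _ _ _ qs cov; rewrite catrevE.
have -> : grows (12 * K) qs by apply: all_leq_grows; apply/allP => q /qsP[].
have : size qs * (4 * K) <= sumn qs.
  have : {in qs, forall q, 4 * K <= q} by move=> q /qsP[/ltnW].
  elim: (qs) => //= q s IH H; rewrite mulSn leq_add ?H ?mem_head ?IH // => x xs.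
  by rewrite H // inE xs orbT.
have := class_primes_size a K oa a4 K13; rewrite -/qs => H6 Hs /(_ isT) Hc m mM.
apply: Hc; nia.
Qed.

(** Since [m < 3 ^ m], tripling [m] times reaches [m]; [0 < M] makes the sum nonempty. *)
Lemma covering_sum a M m : odd a -> a < 4 -> covering a M (4 * 2 ^ 13) (12 * 2 ^ 13) ->
  0 < M <= m ->
  exists s : seq nat,
    [/\ 0 < size s, uniq s, all (fun p => prime p && (p %% 4 == a)) s & sumn s = m].
Proof.
move=> oa a4 base /andP[M0 Mm].
have [ps [ups aps _ cov]] : covering a M (4 * (2 ^ 13 * 3 ^ m)) (12 * (2 ^ 13 * 3 ^ m)).
  elim: (m) => [|j IH]; first by rewrite muln1.
  have := covering_step a M _ oa a4 _ IH.
  rewrite [3 ^ j.+1]expnS; move: (2 ^ 13) (3 ^ j) (expn_gt0 3 j) => c x x0.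
  have -> : 4 * (c * (3 * x)) = 12 * (c * x) by lia.
  have -> : 12 * (c * (3 * x)) = 36 * (c * x) by lia.
  by apply; rewrite leq_pmulr.
have [|s sps E] := cov m.
  have := ltn_expl m (isT : 1 < 3); have := expn_gt0 2 13.
  by move: (2 ^ 13) (3 ^ m) => c x /= c0 mx; rewrite Mm /=; nia.
exists s; split => //.
- by case: s E {sps} => //= E; lia.
- exact: subseq_uniq sps ups.
- by apply/allP => p ps'; apply: (allP aps); apply: mem_subseq sps _ ps'.
Qed.

(** * The base case by computation *)

Fixpoint has_subsum (ps : seq nat) m :=
  if ps is p :: ps' then has_subsum ps' m || (p <= m) && has_subsum ps' (m - p)
  else m == 0.

Lemma has_subsumP ps m : has_subsum ps m -> exists2 s, subseq s ps & sumn s = m.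
Proof.
elim: ps m => [|p ps IH] m /=; first by move=> /eqP->; exists [::].
case/orP => [/IH[s sps <-]|/andP[pm /IH[s sps E]]].
  by exists s => //; apply: subseq_trans sps (subseq_cons _ _).
by exists (p :: s); rewrite /= ?eqxx // E; lia.
Qed.

Lemma covers_has_subsum M L ps : all (has_subsum ps) (iota M L.+1) -> covers M L ps.
Proof. by move=> /allP H m mM; apply/has_subsumP/H; rewrite mem_iota; lia. Qed.

(** Only the short interval filled by [ps] is searched exhaustively; [qs] then lengthens it
    cheaply. *)
Lemma covering_base a M L ps qs B L' :
  all (has_subsum ps) (iota M L.+1) -> grows L qs ->
  uniq (catrev qs ps) -> all (class_prime a) (catrev qs ps) ->
  all (fun p => p <= B) (catrev qs ps) -> L' <= L + sumn qs ->
  covering a M B L'.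
Proof.
move=> /covers_has_subsum cov g u ap bp LL; exists (catrev qs ps); split => // m mM.
by apply: (covers_catrev _ _ _ _ cov g); lia.
Qed.

Lemma covering1 : covering 1 122 (4 * 2 ^ 13) (12 * 2 ^ 13).
Proof.
(* The small primes sum to 725, and [481 = 725 - 2 * 122] makes the interval symmetric under
   complements. Each further prime lies just below the length reached, the last two just below
   [4 * 2 ^ 13]. *)
apply: (@covering_base _ _ 481
  [:: 109; 101; 97; 89; 73; 61; 53; 41; 37; 29; 17; 13; 5]
  [:: 461; 941; 1877; 3733; 7489; 14969; 29921; 32749; 32717]); by vm_compute.
Qed.

Lemma covering3 : covering 3 56 (4 * 2 ^ 13) (12 * 2 ^ 13).
Proof.
(* Likewise, the small primes sum to 460 and [348 = 460 - 2 * 56]. *)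
apply: (@covering_base _ _ 348
  [:: 79; 71; 67; 59; 47; 43; 31; 23; 19; 11; 7; 3]
  [:: 347; 691; 1367; 2731; 5483; 10939; 21871; 32719; 32707]); by vm_compute.
Qed.

Theorem theorem2p5 :
  (forall m : nat, 122 <= m ->
     exists s : seq nat,
       [/\ 0 < size s, uniq s,
           all (fun p => prime p && (p %% 4 == 1)) s & sumn s = m])
  /\
  (forall m : nat, 56 <= m ->
     exists s : seq nat,
       [/\ 0 < size s, uniq s,
           all (fun p => prime p && (p %% 4 == 3)) s & sumn s = m]).
Proof.
split=> m Mm.
  exact: (covering_sum 1 122 m isT isT covering1).
exact: (covering_sum 3 56 m isT isT covering3).
Qed.
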